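(* Let $p$ be a prime, let $e\ge 1$ be an integer and let $g\in\mathbb{Z}[x]$ be a monic divisor of $x^{p^e}-1$. We have $\mathcal{C}(g)=\{1\}$ if $g=(x^{p^j}-1)/(x-1)$ for some $0\le j\le e$. Furthermore, if $p=2$ and $g=(x-1)(x^{2^j}-1)/(x^2-1)$, then for $1\le j\le e$ we have $\mathcal{C}(g)=\{-1,1\}$. In the remaining cases we have $\mathcal{C}(g)=[0,1]$ if $g(1)\neq 0$, and $\mathcal{C}(g)=[-1,1]$ otherwise.
   Context: For a nonzero polynomial $f(x)=\sum_{j} c_jx^j\in\mathbb{Z}[x]$, $\mathcal{C}(f)=\{c_j : 0\le j\le \deg f\}$ denotes its set of coefficients. For integers $a\le b$, $[a,b]$ denotes the set of consecutive integers $\{a,a+1,\ldots,b\}$.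
   Formalization: For odd p and g = x − 1 the coefficient set is {−1, 1}, not [−1,1] as the remaining cases would claim; this case is excluded from the remaining cases and stated separately with the set {−1, 1}. *)

(* Defs.v *)
From HB Require Import structures.
From mathcomp Require Import all_boot all_order all_algebra.
Set Implicit Arguments.
Unset Strict Implicit.
Unset Printing Implicit Defensive.
Import Order.TTheory GRing.Theory Num.Theory.
Local Open Scope ring_scope.

(* The underlying sequence of a nonzero polynomial has no trailing zeros: it
   lists exactly the coefficients of index 0, ..., deg f.  So 0 belongs to the
   set only when some coefficient of index at most deg f vanishes. *)
Definition coefset (f : {poly int}) : {pred int} := [pred c | c \in polyseq f].

(* The divisors below are monic and the divisions are exact, so the
   pseudo-division %/ is the genuine quotient in Z[x]. *)
Definition all_ones_case (p e : nat) (g : {poly int}) : Prop :=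
  exists2 j : nat, (j <= e)%N & g = ('X^(p ^ j) - 1) %/ ('X - 1).

Definition alternating_case (p e : nat) (g : {poly int}) : Prop :=
  p = 2%N /\
  exists2 j : nat, (1 <= j <= e)%N &
    g = (('X - 1) * ('X^(2 ^ j) - 1)) %/ ('X^2 - 1).

(* The divisor x - 1 has coefficient set {-1, 1} for every p.  When p = 2 it is
   the instance j = 1 of alternating_case; for odd p it must be listed apart,
   since 0 is not one of its coefficients. *)
Definition odd_linear_case (p : nat) (g : {poly int}) : Prop :=
  p <> 2%N /\ g = 'X - 1.

(* Main.v *)
(* Since Phi_(p^(k+1)) = 1 + y + ... + y^(p-1) with y = X^(p^k) is irreducible,
   g is a product of distinct Phi_(p^i).  The product F of those with i >= 1
   satisfies F = F'(X^p) or F = (1 + X + ... + X^(p-1)) F'(X^p) with F' of the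
   same shape, so its n-th coefficient is 1 when the nonzero base-p digits of n
   sit at the positions of the chosen factors, and 0 otherwise.  The remaining
   case is g = (X - 1) F, whose coefficients are differences of consecutive
   coefficients of F; no such difference vanishes only if F alternates
   1, 0, 1, 0, ..., which for F <> 1 forces p = 2. *)
Require Import Defs.
From HB Require Import structures.
From mathcomp Require Import all_boot all_order all_algebra.
From mathcomp Require Import algC cyclotomic.
Set Implicit Arguments.
Unset Strict Implicit.
Unset Printing Implicit Defensive.
Import Order.TTheory GRing.Theory Num.Theory.
Local Open Scope ring_scope.

(** * Substitution of a power of X, and all-ones polynomials *)

Lemma monic_comp_Xn (R : idomainType) (f : {poly R}) (n : nat) :
  (0 < n)%N -> f \is monic -> f \Po 'X^n \is monic.
Proof.
move=> n_gt0 /monicP f1; rewrite monicE lead_coef_comp ?size_polyXn ?ltnS //.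
by rewrite f1 lead_coefXn expr1n mulr1.
Qed.

Lemma size_comp_Xn (R : idomainType) (f : {poly R}) (n : nat) :
  (0 < n)%N -> f != 0 -> size (f \Po 'X^n) = ((size f).-1 * n).+1.
Proof.
move=> n_gt0 f_neq0.
have fX_neq0: f \Po 'X^n != 0.
  rewrite -lead_coef_eq0 lead_coef_comp ?size_polyXn ?ltnS // lead_coefXn
    expr1n.
  by rewrite mulr1 lead_coef_eq0.
by have:= size_comp_poly f 'X^n; rewrite size_polyXn /= => <-;
  rewrite prednK ?size_poly_gt0.
Qed.

Definition ones (n : nat) : {poly int} := \poly_(i < n) 1.

Lemma size_ones n : size (ones n) = n.
Proof. by rewrite size_poly_eq ?oner_eq0. Qed.

Lemma coef_ones n i : (ones n)`_i = (i < n)%:R.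
Proof. by rewrite coef_poly; case: ltnP. Qed.

Lemma ones1 : ones 1 = 1.
Proof. by rewrite /ones poly_def big_ord1 scale1r expr0. Qed.

Lemma ones_monic n : (0 < n)%N -> ones n \is monic.
Proof. by move=> n0; rewrite monicE lead_coefE size_ones coef_ones prednK
  ?leqnn. Qed.

Lemma onesM_XsubC1 n : ones n * ('X - 1) = 'X^n - 1.
Proof.
rewrite subrX1 mulrC /ones poly_def; congr (_ * _).
by apply: eq_bigr => i _; rewrite scale1r.
Qed.

(** * Cyclotomic polynomials of prime power order and factorization of the divisors *)

(* The cyclotomic polynomial Phi_(p^(k+1)), for p prime. *)
Definition cyc (p k : nat) : {poly int} := ones p \Po 'X^(p ^ k).

(** After multiplication by X - 1 both sides become X^(mn) - 1, because X^m - 1 is X - 1 evaluated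
    at X^m. *)
Lemma onesM m n : ones m * (ones n \Po 'X^m) = ones (m * n).
Proof.
apply: (mulIf (monic_neq0 (monicXsubC 1))); rewrite mulrAC !onesM_XsubC1 mulrC.
have <- : ('X - 1) \Po 'X^m = 'X^m - 1 :> {poly int}.
  by rewrite comp_polyB comp_polyX comp_polyC.
rewrite -comp_polyM onesM_XsubC1 comp_polyB comp_polyC exprM.
by rewrite rmorphXn /= comp_polyX.
Qed.

Lemma cycM_Xn_sub1 p k : cyc p k * ('X^(p ^ k) - 1) = 'X^(p ^ k.+1) - 1.
Proof. by rewrite -onesM_XsubC1 mulrA [cyc p k * _]mulrC onesM onesM_XsubC1
  expnSr. Qed.

Lemma cyc_monic p k : (0 < p)%N -> cyc p k \is monic.
Proof. by move=> p_gt0; apply: monic_comp_Xn;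
  rewrite ?expn_gt0 ?p_gt0 ?ones_monic. Qed.

(* cyc p k is the minimal polynomial of a primitive p^(k+1)-th root of unity. *)
Lemma cyc_prime p k (g h : {poly int}) :
    prime p -> cyc p k %| h * g -> (cyc p k %| h) || (cyc p k %| g).
Proof.
move=> p_pr; have p_gt0 := prime_gt0 p_pr; have p_gt1 := prime_gt1 p_pr.
have [z z_prim] := C_prim_root_exists (ltn_trans (ltn0Sn 0) (ltn_exp2l 0 k.+1
  p_gt1)).
have [m [m_min m_mon m_dvd]] := minCpolyP z.
pose toQ (f : {poly int}) : {poly rat} := map_poly intr f.
have cycQ_mon : toQ (cyc p k) \is monic by rewrite monic_map ?cyc_monic.
(* Divisibility by the minimal polynomial [m] means vanishing at [z], and a product vanishing at [z]
   has a factor vanishing there. *)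
suff m_cyc : m = toQ (cyc p k).
  rewrite -!dvdp_rat_int -/(toQ _) -/(toQ h) -/(toQ g) -m_cyc.
  by rewrite rmorphM /= -!m_dvd rmorphM /= rootM.
(* Both polynomials are monic of degree totient(p^(k+1)) = (p - 1) p^k, so it suffices that [m]
   divides, i.e. that [z] is a root of [cyc p k]. *)
apply/eqP; rewrite -eqp_monic // -dvdp_size_eqp.
  rewrite size_map_inj_poly ?mulr0z //; last exact: intr_inj.
  rewrite -(size_map_poly (ratr : {rmorphism rat -> algC})) -m_min.
  rewrite (minCpoly_cyclotomic z_prim) size_cyclotomic totient_pfactor //=.
  rewrite size_comp_Xn ?size_ones ?eqxx ?expn_gt0 ?p_gt0 //.
  by rewrite monic_neq0 ?ones_monic.
rewrite -m_dvd.
have ZtoC f : map_poly ratr (toQ f) = map_poly intr f :> {poly algC}.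
  by rewrite -map_poly_comp; apply: eq_map_poly => i /=; rewrite ratr_int.
have : root (map_poly intr ('X^(p ^ k.+1) - 1) : {poly algC}) z.
  by rewrite rmorphB /= map_polyXn rmorph1 rootE !hornerE (prim_expr_order
    z_prim) subrr.
(* The cofactor X^(p^k) - 1 does not vanish at [z], whose order p^(k+1) does not divide p^k. *)
rewrite -cycM_Xn_sub1 rmorphM /= rootM ZtoC => /orP[//|].
rewrite rmorphB /= map_polyXn rmorph1 rootE !hornerE subr_eq0 -(prim_order_dvd
  z_prim).
by rewrite dvdn_Pexp2l // ltnn.
Qed.

(* The product of the Phi_(p^(i+1)) over the positions i of bs holding true. *)
Fixpoint cycprod (p : nat) (bs : seq bool) : {poly int} :=
  if bs is b :: bs' then (if b then ones p else 1) * (cycprod p bs' \Po 'X^p)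
  else 1.

(** The recursion of [cycprod] peels off position 0, whereas the induction on e below splits off the
    factor at the highest position. *)
Lemma cycprod_rcons p bs b :
  cycprod p (rcons bs b) = cycprod p bs * (if b then cyc p (size bs) else 1).
Proof.
elim: bs => [|b' bs IH] /=.
  by rewrite mul1r comp_polyC mulr1 /cyc expn0 expr1 comp_polyXr.
rewrite IH comp_polyM mulrA; congr (_ * _).
case: b {IH} => //; last by rewrite comp_polyC.
by rewrite /cyc -comp_polyA rmorphXn /= comp_polyX -exprM -expnS.
Qed.

Lemma monic_size1 (R : nzRingType) (f : {poly R}) :
  f \is monic -> (size f <= 1)%N -> f = 1.
Proof.
move=> f_mon f_sz; move: f_mon; rewrite (size1_polyC f_sz) monicE lead_coefC.
by move=> /eqP ->.
Qed.

(** Induction on e: the prime factor [cyc p e] of X^(p^(e+1)) - 1 divides h or g, and cancelling it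
    leaves a factorization of X^(p^e) - 1. The bit [b] records whether X - 1 divides g. *)
Lemma divisor_cycprod p e (g h : {poly int}) :
    prime p -> g \is monic -> 'X^(p ^ e) - 1 = h * g ->
  exists (bs : seq bool) (b : bool), size bs = e /\ g = ('X - 1) ^+ b * cycprod
    p bs.
Proof.
move=> p_pr; elim: e g h => [|e IH] g h g_mon def_hg.
  (* Here h g = X - 1 has degree 1, so one of the two monic factors is 1. *)
  rewrite expn0 expr1 in def_hg.
  have h_mon : h \is monic by rewrite -(monicMr h g_mon) -def_hg monicXsubC.
  have := size_monicM h_mon (monic_neq0 g_mon).
  rewrite -def_hg size_XsubC => hg_sz; exists [::].
  case: (leqP (size h) 1) => h_sz.
    exists true; split=> //=; rewrite expr1 mulr1 def_hg.
    by rewrite (monic_size1 h_mon h_sz) mul1r.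
  exists false; split=> //=; rewrite expr0 mulr1; apply: monic_size1 => //.
  by case: (size h) h_sz hg_sz => [|[|n]] //= _; case=> sz;
    apply: leq_trans (leq_addl n _) _; rewrite -sz.
have p_gt0 := prime_gt0 p_pr; have c_mon := cyc_monic e p_gt0.
have c_n0 := monic_neq0 c_mon.
move: def_hg; rewrite -cycM_Xn_sub1 => def_hg.
have /(cyc_prime p_pr) : cyc p e %| h * g by rewrite -def_hg dvdp_mulIl.
case/orP => /(Pdiv.IdomainMonic.dvdpP c_mon)[q def_q].
  have [|bs [b [sz_bs def_g]]] := IH g q g_mon.
    by apply: (mulfI c_n0); rewrite def_hg def_q mulrA [q * _]mulrC.
  exists (rcons bs false), b; rewrite size_rcons sz_bs; split=> //.
  by rewrite cycprod_rcons mulr1.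
have q_mon : q \is monic by rewrite -(monicMr q c_mon) -def_q.
have [|bs [b [sz_bs def_g]]] := IH q h q_mon.
  by apply: (mulfI c_n0); rewrite def_hg def_q mulrA mulrC.
exists (rcons bs true), b; rewrite size_rcons sz_bs; split=> //.
by rewrite cycprod_rcons sz_bs def_q def_g mulrA.
Qed.


(** * Coefficients of the products without the factor X - 1 *)

Lemma cycprod_monic p bs : (0 < p)%N -> cycprod p bs \is monic.
Proof.
move=> p_gt0; elim: bs => [|b bs IH] /=; first exact: monic1.
by rewrite monicMr ?monic_comp_Xn //; case: b; rewrite ?ones_monic ?monic1.
Qed.

Lemma coef_cycprod_cons p b bs n : (0 < p)%N ->
  (cycprod p (b :: bs))`_n =
    if b || (p %| n)%N then (cycprod p bs)`_(n %/ p) else 0.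
Proof.
move=> p_gt0 /=; case: b => /=; last by rewrite mul1r coef_comp_poly_Xn.
(* In the convolution only j = n mod p survives: it is the only j < p for which p divides n - j. *)
have r_lt : (n %% p < n.+1)%N by rewrite ltnS leq_mod.
rewrite coefM (bigD1 (Ordinal r_lt)) //= coef_ones ltn_pmod // mul1r.
rewrite coef_comp_poly_Xn // {1 3}(divn_eq n p) addnK dvdn_mull // mulnK //.
rewrite big1 ?addr0 // => j /eqP j_neq; rewrite coef_ones.
case: ltnP => [j_lt|_]; last by rewrite mul0r.
rewrite coef_comp_poly_Xn //; case: ifP => [p_dvd|_]; last by rewrite mulr0.
case: j_neq; apply: val_inj => /=; have j_le : (j <= n)%N by rewrite -ltnS.
by have := modnMDl ((n - j) %/ p) j p;
  rewrite divnK // subnK // (modn_small j_lt).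
Qed.

Lemma cycprod0 p bs : (0 < p)%N -> (cycprod p bs)`_0 = 1.
Proof.
move=> p_gt0; elim: bs => [|b bs IH]; first by rewrite coef1.
by rewrite coef_cycprod_cons // dvdn0 orbT div0n.
Qed.

Lemma coef_cycprod01 p bs n :
  (0 < p)%N -> (cycprod p bs)`_n = 0 \/ (cycprod p bs)`_n = 1.
Proof.
move=> p_gt0; elim: bs n => [|b bs IH] n.
  by rewrite coef1; case: eqP; [right | left].
by rewrite coef_cycprod_cons //; case: ifP; [|left].
Qed.

Lemma size_cycprod_cons p b bs : (0 < p)%N ->
  size (cycprod p (b :: bs)) =
    (b * p.-1 + (size (cycprod p bs)).-1 * p).+1.
Proof.
move=> p_gt0 /=; have F_mon := cycprod_monic bs p_gt0.
have FX_neq0 := monic_neq0 (monic_comp_Xn p_gt0 F_mon).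
have F_neq0 := monic_neq0 F_mon.
case: b; last by rewrite mul1r size_comp_Xn.
rewrite size_monicM ?ones_monic // size_ones size_comp_Xn //.
by rewrite addnS /= mul1n -addSn prednK.
Qed.

(** Each chosen factor takes the value p at 1. So g(1) = 0 exactly when X - 1 is a factor of g. *)
Lemma horner_cycprod1 p bs : (0 < p)%N -> (cycprod p bs).[1] != 0.
Proof.
move=> p_gt0; elim: bs => [|b bs IH] /=; first by rewrite hornerC oner_eq0.
rewrite hornerM horner_comp hornerXn expr1n mulf_neq0 //.
case: b; last by rewrite hornerC oner_eq0.
rewrite horner_poly (eq_bigr (fun=> 1)) => [|i _]; last by rewrite expr1n mulr1.
by rewrite sumr_const card_ord pnatr_eq0 -lt0n.
Qed.

(** All coefficients are 1 only when the chosen positions form an initial segment. A gap of the tail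
    at n moves to np; if position 0 is skipped and the tail is not 1, there is a gap at 1. *)
Lemma cycprod_ones_or_gap p bs : (1 < p)%N ->
  (exists2 j, (j <= size bs)%N & cycprod p bs = ones (p ^ j)) \/
  (exists2 n, (n < size (cycprod p bs))%N & (cycprod p bs)`_n = 0).
Proof.
move=> p_gt1; have p_gt0 := ltnW p_gt1.
elim: bs => [|b bs]; first by left; exists 0%N; rewrite ?expn0 ?ones1.
case=> [[j j_le F_ones]|[n n_lt Fn]]; last first.
  right; exists (n * p)%N;
    last by rewrite coef_cycprod_cons // dvdn_mull // orbT mulnK.
  rewrite size_cycprod_cons // ltnS; apply: leq_trans (leq_addl _ _).
  by rewrite leq_mul2r -ltnS prednK ?n_lt ?orbT //; apply: leq_ltn_trans n_lt.
case: b.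
  by left; exists j.+1 => //=; rewrite F_ones onesM expnS.
case: j j_le F_ones => [|j] j_le F_ones.
  by left; exists 0%N => //=; rewrite F_ones expn0 ones1 comp_polyC mulr1.
right; exists 1%N; last by rewrite coef_cycprod_cons // dvdn1 gtn_eqF.
rewrite size_cycprod_cons // F_ones size_ones ltnS mul0n muln_gt0 p_gt0 andbT.
by have := ltn_exp2l 0 j.+1 p_gt1; rewrite expn0; case: (p ^ _)%N => [|[]].
Qed.

(** Two equal consecutive coefficients of F give a zero coefficient of (X - 1) F. They sit at 0, 1
    if position 0 is chosen, and at 1, 2 if it is skipped, p > 2 and F is not 1. *)
Lemma cycprod_alternating_or_repeat p bs : (1 < p)%N ->
  [\/ cycprod p bs = 1,
      p = 2%N /\ exists2 j, (j < size bs)%N & cycprod p bs = ones (2 ^ j) \Po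
        'X^2
    | exists2 n, (n.+1 < size (cycprod p bs))%N &
        (cycprod p bs)`_n = (cycprod p bs)`_n.+1].
Proof.
move=> p_gt1; have p_gt0 := ltnW p_gt1.
case: bs => [|[] bs]; first by constructor 1.
  constructor 3; exists 0%N; last by rewrite !coef_cycprod_cons // !divn_small.
  by rewrite size_cycprod_cons // ltnS mul1n ltn_addr // -ltnS prednK.
have F_mon := cycprod_monic bs p_gt0.
have [/(monic_size1 F_mon) F1|F_sz] := leqP (size (cycprod p bs)) 1.
  by constructor 1; rewrite /= F1 comp_polyC mulr1.
have [p_gt2|p_le2] := ltnP 2 p.
  constructor 3; exists 1%N.
    rewrite size_cycprod_cons // ltnS mul0n add0n (leq_trans p_gt1) //.
    by rewrite leq_pmull // -ltnS prednK // ltnW.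
  by rewrite !coef_cycprod_cons //= dvdn1 gtn_eqF // gtnNdvd.
have p2 : p = 2%N by apply/eqP; rewrite eqn_leq p_le2.
have [[j j_le F_ones]|[[|n] n_lt Fn]] := cycprod_ones_or_gap bs p_gt1.
- constructor 2; split=> //; exists j; rewrite ?ltnS //=.
  by rewrite mul1r F_ones p2.
- by move: Fn; rewrite cycprod0.
(* With p = 2 the odd coefficients vanish, so the gap of the tail, moved to 2(n + 1), follows the
   zero at 2n + 1. *)
constructor 3; exists (n.+1 * p).-1.
  rewrite prednK ?muln_gt0 // size_cycprod_cons // ltnS mul0n add0n leq_mul2r.
  by rewrite -ltnS prednK ?n_lt ?orbT //; apply: leq_ltn_trans n_lt.
rewrite prednK ?muln_gt0 // !coef_cycprod_cons //= dvdn_mull // mulnK // Fn.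
by case: ifP => //; rewrite p2 mulSn addSn /= dvdn2 /= oddM andbF.
Qed.

(** * Coefficient sets and the final case analysis *)

Lemma coefsetP (f : {poly int}) c :
  reflect (exists2 n, (n < size f)%N & f`_n = c) (c \in coefset f).
Proof. exact: nthP. Qed.

Lemma coefset_ones n : (0 < n)%N -> coefset (ones n) =i pred1 1.
Proof.
move=> n_gt0 c; apply/coefsetP/eqP => [[i]|->].
  by rewrite size_ones coef_ones => -> <-.
by exists 0%N; rewrite ?size_ones // coef_ones n_gt0.
Qed.

Lemma coefset_XsubC1 : coefset ('X - 1) =i pred2 (-1 : int) 1.
Proof. by move=> c; rewrite /coefset inE polyseqXsubC !inE. Qed.

Lemma coef_XsubC1M (f : {poly int}) n :
  (('X - 1) * f)`_n = (if n is m.+1 then f`_m else 0) - f`_n.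
Proof. by rewrite mulrBl mul1r coefB coefXM; case: n. Qed.

Lemma size_XsubC1M (f : {poly int}) :
  f != 0 -> size (('X - 1) * f) = (size f).+1.
Proof. by move=> f_neq0; rewrite size_monicM ?monicXsubC // size_XsubC. Qed.

Lemma cycprod_XsubC1M_N1 p bs : (0 < p)%N ->
  (-1 : int) \in coefset (('X - 1) * cycprod p bs).
Proof.
move=> p_gt0; have F_n0 := monic_neq0 (cycprod_monic bs p_gt0).
apply/coefsetP; exists 0%N; first by rewrite size_XsubC1M.
by rewrite coef_XsubC1M cycprod0 ?sub0r.
Qed.

Lemma coefset_monic (f : {poly int}) : f \is monic -> 1 \in coefset f.
Proof.
move=> f_mon; apply/coefsetP; exists (size f).-1; last exact/monicP.
by rewrite prednK // size_poly_gt0 monic_neq0.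
Qed.

Lemma coefset_alternating n : (0 < n)%N ->
  coefset (('X - 1) * (ones n \Po 'X^2)) =i pred2 (-1 : int) 1.
Proof.
move=> n_gt0 c; have o_mon := ones_monic n_gt0.
have f_mon : ones n \Po 'X^2 \is monic by rewrite monic_comp_Xn.
have f_sz : size (ones n \Po 'X^2) = (n.*2).-1.
  rewrite size_comp_Xn ?monic_neq0 // size_ones muln2.
  by case: n n_gt0 {o_mon f_mon}.
(* The bound 2n replaces the size 2n - 1 harmlessly, the extra index being odd; it is also the size
   of the product with X - 1. *)
have f_coef i : (ones n \Po 'X^2)`_i = (~~ odd i && (i < n.*2)%N)%:R.
  rewrite coef_comp_poly_Xn // dvdn2 coef_ones ltn_divLR // muln2.
  by case: odd.
have g_mon : ('X - 1) * (ones n \Po 'X^2) \is monic.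
  by rewrite monicMr // monicXsubC.
rewrite !inE; apply/idP/orP => [/coefsetP[i]|[]/eqP->]; last 2 first.
- apply/coefsetP; exists 0%N; first by rewrite size_XsubC1M ?monic_neq0.
  by rewrite coef_XsubC1M f_coef double_gt0 n_gt0 sub0r.
- exact: coefset_monic.
rewrite size_XsubC1M ?monic_neq0 // f_sz prednK ?double_gt0 // coef_XsubC1M.
move=> i_lt <-; rewrite f_coef i_lt andbT; case: i i_lt => [|i] i_lt /=.
  by left; rewrite sub0r.
by rewrite f_coef (ltnW i_lt) andbT; case: odd; rewrite /= ?sub0r ?subr0 eqxx;
  [left|right].
Qed.

Lemma int_itv01 (c : int) : (c \in `[0 : int, 1]) = (c \in [:: 0; 1]).
Proof. by case: c => [[|[|n]]|n]. Qed.

Lemma int_itvN11 (c : int) : (c \in `[-1 : int, 1]) = (c \in [:: -1; 0; 1]).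
Proof. by case: c => [[|[|n]]|[|n]]. Qed.

Theorem theorem1 (p e : nat) (g : {poly int})
    (p_prime : prime p) (e_ge1 : (1 <= e)%N) (g_monic : g \is monic)
    (g_dvd : exists h : {poly int}, 'X^(p ^ e) - 1 = h * g) :
  [/\ all_ones_case p e g -> coefset g =i pred1 (1 : int),
      alternating_case p e g -> coefset g =i pred2 (-1 : int) 1,
      odd_linear_case p g -> coefset g =i pred2 (-1 : int) 1
    & ~ all_ones_case p e g -> ~ alternating_case p e g ->
      ~ odd_linear_case p g ->
      (g.[1] != 0 -> coefset g =i `[0 : int, 1]) /\
      (g.[1] = 0 -> coefset g =i `[-1 : int, 1])].
Proof.
have p_gt1 := prime_gt1 p_prime; have p_gt0 := prime_gt0 p_prime.
have X1_mon : 'X - 1 \is monic := monicXsubC (1 : int).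
have ones_quo n : ('X^n - 1) %/ ('X - 1) = ones n.
  by rewrite -onesM_XsubC1 Pdiv.IdomainMonic.mulpK.
have alt_quo j : (('X - 1) * ('X^(2 ^ j.+1) - 1)) %/ ('X^2 - 1)
                 = ('X - 1) * (ones (2 ^ j) \Po 'X^2) :> {poly int}.
  rewrite [X in X %/ _](_ : _ = ('X - 1) * (ones (2 ^ j) \Po 'X^2) * ('X^2 -
    1)).
    by rewrite Pdiv.IdomainMonic.mulpK // monicXnsubC.
  by rewrite -!onesM_XsubC1 expnS -onesM -!mulrA [ones 2 * _]mulrCA.
split=> [[j _ ->]|[p2 [[|j] // _ ->]]|[_ ->]|not_ones not_alt not_lin].
- by rewrite ones_quo; apply: coefset_ones; rewrite expn_gt0 p_gt0.
- by rewrite alt_quo; apply: coefset_alternating; rewrite expn_gt0.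
- exact: coefset_XsubC1.
have [h def_hg] := g_dvd.
have [bs [b [bs_sz def_g]]] := divisor_cycprod p_prime g_monic def_hg.
have g_1 := coefset_monic g_monic.
have F_mon := cycprod_monic bs p_gt0; have F_neq0 := monic_neq0 F_mon.
case: b def_g => def_g; rewrite ?expr1 ?expr0 ?mul1r in def_g.
  split=> [|_ c].
    by rewrite def_g hornerM hornerXsubC subrr mul0r eqxx.
  rewrite int_itvN11 !inE; apply/idP/or3P => [|[] /eqP-> //].
  (* Each coefficient is a difference of two elements of {0, 1}. *)
  - case/coefsetP=> n _ <-; rewrite def_g coef_XsubC1M.
    have [] := coef_cycprod01 bs n p_gt0 => ->.
      case: n => [|n]; first by rewrite subr0; constructor 2.
      have [] := coef_cycprod01 bs n p_gt0 => ->; rewrite subr0.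
        by constructor 2.
      by constructor 3.
    case: n => [|n]; first by rewrite sub0r; constructor 1.
    have [] := coef_cycprod01 bs n p_gt0 => ->.
      by rewrite sub0r; constructor 1.
    by rewrite subrr; constructor 2.
  - by rewrite def_g cycprod_XsubC1M_N1.
  (* It remains to find the coefficient 0. F = 1 gives X - 1, excluded as the alternating case j = 1
     or as the odd linear case; alternating F is excluded too, and a repeat yields the zero. *)
  have [F1|[p2 [j j_lt F_alt]]|[n n_lt Fn]] := cycprod_alternating_or_repeat bs
    p_gt1.
  - rewrite F1 mulr1 in def_g; have [p2|/eqP p_neq2] := eqVneq p 2.
      case: not_alt; split=> //; exists 1%N; rewrite ?e_ge1 //.
      by rewrite alt_quo expn0 ones1 comp_polyC mulr1.
    by case: not_lin.
  - case: not_alt; split=> //; exists j.+1; rewrite ?andbT -?bs_sz //.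
    by rewrite def_g F_alt alt_quo.
  apply/coefsetP; exists n.+1; first by rewrite def_g size_XsubC1M // ltnW.
  by rewrite def_g coef_XsubC1M Fn subrr.
split=> [_ c|]; last by rewrite def_g => /eqP;
  rewrite (negbTE (horner_cycprod1 _ p_gt0)).
rewrite int_itv01 !inE; apply/idP/orP => [|[] /eqP-> //].
  case/coefsetP=> n _ <-; rewrite def_g.
  by have [] := coef_cycprod01 bs n p_gt0 => ->; [left | right].
(* Again only 0 is left to find: without a gap, g would be an excluded all-ones polynomial. *)
have [[j j_le F_ones]|[n n_lt Fn]] := cycprod_ones_or_gap bs p_gt1.
  by case: not_ones; exists j; rewrite -?bs_sz // ones_quo def_g.
by apply/coefsetP; exists n; rewrite def_g.
Qed.
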